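(* Let $A,A'$ be two $k$-algebras. The categories $\mathrm{Rep}(A,\mathcal{A})$ and $\mathrm{Rep}(A',\mathcal{A})$ of their representations in any $k$-linear abelian category $\mathcal{A}$ are equivalent if and only if their module categories $\mathrm{Mod}(A)$ and $\mathrm{Mod}(A')$ are equivalent. That is, $\mathrm{Rep}(A,\mathcal{A})\simeq\mathrm{Rep}(A',\mathcal{A})$ for every $k$-linear abelian category $\mathcal{A}$ if and only if $\mathrm{Mod}(A)\simeq\mathrm{Mod}(A')$.
   Context: $k$ is a fixed PID. $\mathrm{Mod}(A)$ is the category of finitely generated left $A$-modules. A representation of a $k$-algebra $A$ in a $k$-linear category $\mathcal{C}$ is a $k$-algebra morphism $A\to\mathrm{End}_{\mathcal{C}}(M)$ for some object $M\in\mathcal{C}$. Morphisms of representations are the morphisms in $\mathcal{C}$ between the underlying objects that commute with the action of $A$. *)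

(* Defs.v *)
From HB Require Import structures.
From mathcomp Require Import all_boot all_order all_algebra.
From mathcomp Require Import boolp.

Set Implicit Arguments.
Unset Strict Implicit.
Unset Printing Implicit Defensive.
#[local] Obligation Tactic := idtac.

Import GRing.Theory.
Local Open Scope ring_scope.

Definition is_ideal (k : idomainType) (I : k -> Prop) : Prop :=
  [/\ I 0, forall x y, I x -> I y -> I (x + y) & forall a x, I x -> I (a * x)].

Definition is_pid (k : idomainType) : Prop :=
  forall I : k -> Prop, is_ideal I ->
    exists a : k, forall x, I x <-> exists b, x = b * a.

(* Unital associative k-algebras, given by a central structure morphism.
   MathComp's algType extends nzRingType and so excludes the zero algebra,
   which is allowed here. *)
Record kalgebra (k : comNzRingType) := KAlgebra {
  alg_ring :> pzRingType;
  alg_map : {rmorphism k -> alg_ring};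
  alg_central : forall (c : k) (a : alg_ring), alg_map c * a = a * alg_map c
}.

Record kalgebra_hom (k : comNzRingType) (A B : kalgebra k) := KAlgebraHom {
  alg_hom :> {rmorphism A -> B};
  alg_hom_map : forall c : k, alg_hom (alg_map A c) = alg_map B c
}.

(* k-linear categories. The Hom-objects are k-modules compared with Leibniz
   equality, and composition is written in the order of functions. *)
Record lincat (k : comNzRingType) := LinCat {
  ob :> Type;
  mor : ob -> ob -> lmodType k;
  idm : forall X, mor X X;
  mcomp : forall X Y Z, mor Y Z -> mor X Y -> mor X Z;
  mcomp1m : forall X Y (f : mor X Y), mcomp (idm Y) f = f;
  mcompm1 : forall X Y (f : mor X Y), mcomp f (idm X) = f;
  mcompA : forall X Y Z W (f : mor Z W) (g : mor Y Z) (h : mor X Y),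
    mcomp f (mcomp g h) = mcomp (mcomp f g) h;
  mcompDl : forall X Y Z (f g : mor Y Z) (h : mor X Y),
    mcomp (f + g) h = mcomp f h + mcomp g h;
  mcompDr : forall X Y Z (f : mor Y Z) (g h : mor X Y),
    mcomp f (g + h) = mcomp f g + mcomp f h;
  mcompZl : forall X Y Z (c : k) (f : mor Y Z) (g : mor X Y),
    mcomp (c *: f) g = c *: mcomp f g;
  mcompZr : forall X Y Z (c : k) (f : mor Y Z) (g : mor X Y),
    mcomp f (c *: g) = c *: mcomp f g
}.

Arguments mor {k l} X Y.
Arguments idm {k l} X.
Arguments mcomp {k l X Y Z} f g.

Notation "f \oc g" := (mcomp f g) (at level 40, left associativity) : ring_scope.

Lemma mcomp0m (k : comNzRingType) (C : lincat k) (X Y Z : C) (f : mor X Y) :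
  (0 : mor Y Z) \oc f = 0.
Proof. by rewrite -(scale0r (0 : mor Y Z)) mcompZl scale0r. Qed.

Lemma mcompm0 (k : comNzRingType) (C : lincat k) (X Y Z : C) (f : mor Y Z) :
  f \oc (0 : mor X Y) = 0.
Proof. by rewrite -(scale0r (0 : mor X Y)) mcompZr scale0r. Qed.

Section Abelian.
Variables (k : comNzRingType) (C : lincat k).

Definition is_iso (X Y : C) (f : mor X Y) : Prop :=
  exists g : mor Y X, g \oc f = idm X /\ f \oc g = idm Y.

Definition is_mono (X Y : C) (f : mor X Y) : Prop :=
  forall (Z : C) (g h : mor Z X), f \oc g = f \oc h -> g = h.

Definition is_epi (X Y : C) (f : mor X Y) : Prop :=
  forall (Z : C) (g h : mor Y Z), g \oc f = h \oc f -> g = h.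

Definition is_zero_ob (X : C) : Prop :=
  forall Y : C, (exists! f : mor X Y, True) /\ (exists! f : mor Y X, True).

Definition is_biproduct (X1 X2 S : C) (i1 : mor X1 S) (i2 : mor X2 S)
    (p1 : mor S X1) (p2 : mor S X2) : Prop :=
  [/\ p1 \oc i1 = idm X1, p2 \oc i2 = idm X2, p1 \oc i2 = 0, p2 \oc i1 = 0
    & i1 \oc p1 + i2 \oc p2 = idm S].

Definition is_kernel (X Y K : C) (f : mor X Y) (i : mor K X) : Prop :=
  f \oc i = 0 /\
  forall (Z : C) (g : mor Z X), f \oc g = 0 -> exists! h : mor Z K, i \oc h = g.

Definition is_cokernel (X Y Q : C) (f : mor X Y) (p : mor Y Q) : Prop :=
  p \oc f = 0 /\
  forall (Z : C) (g : mor Y Z), g \oc f = 0 -> exists! h : mor Q Z, h \oc p = g.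

Record is_abelian : Prop := Abelian {
  ab_zero : exists Z : C, is_zero_ob Z;
  ab_biproduct : forall X1 X2 : C, exists (S : C) (i1 : mor X1 S)
    (i2 : mor X2 S) (p1 : mor S X1) (p2 : mor S X2), is_biproduct i1 i2 p1 p2;
  ab_kernel : forall (X Y : C) (f : mor X Y),
    exists (K : C) (i : mor K X), is_kernel f i;
  ab_cokernel : forall (X Y : C) (f : mor X Y),
    exists (Q : C) (p : mor Y Q), is_cokernel f p;
  ab_mono : forall (X Y : C) (f : mor X Y), is_mono f ->
    exists (Z : C) (g : mor Y Z), is_kernel g f;
  ab_epi : forall (X Y : C) (f : mor X Y), is_epi f ->
    exists (Z : C) (g : mor Z X), is_cokernel g f
}.

End Abelian.

Record linfunctor (k : comNzRingType) (C D : lincat k) := LinFunctor {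
  fob :> C -> D;
  fhom : forall X Y : C, {linear mor X Y -> mor (fob X) (fob Y)};
  fhom1 : forall X : C, fhom X X (idm X) = idm (fob X);
  fhomM : forall (X Y Z : C) (f : mor Y Z) (g : mor X Y),
    fhom X Z (f \oc g) = fhom Y Z f \oc fhom X Y g
}.
Arguments fhom {k C D} l {X Y}.

Section Functors.
Variable k : comNzRingType.

Program Definition id_functor (C : lincat k) : linfunctor C C :=
  @LinFunctor k C C id (fun X Y => idfun) _ _.
Next Obligation. by []. Qed.
Next Obligation. by []. Qed.

Program Definition comp_functor (C D E : lincat k) (G : linfunctor D E)
    (F : linfunctor C D) : linfunctor C E :=
  @LinFunctor k C E (G \o F) (fun X Y => fhom G \o fhom F) _ _.
Next Obligation. by move=> *; rewrite /= !fhom1. Qed.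
Next Obligation. by move=> *; rewrite /= !fhomM. Qed.

Definition nat_iso (C D : lincat k) (F G : linfunctor C D) : Prop :=
  exists eta : forall X : C, mor (F X) (G X),
    (forall X, is_iso (eta X)) /\
    (forall (X Y : C) (f : mor X Y), eta Y \oc fhom F f = fhom G f \oc eta X).

(* Equivalence of k-linear categories, that is, by k-linear functors. *)
Definition lin_equivalent (C D : lincat k) : Prop :=
  exists (F : linfunctor C D) (G : linfunctor D C),
    nat_iso (comp_functor G F) (id_functor C) /\
    nat_iso (comp_functor F G) (id_functor D).

End Functors.

Section ModuleCategory.
Variables (k : comNzRingType) (A : kalgebra k).

Definition finitely_generated (M : lmodType A) : Prop :=
  exists (n : nat) (e : 'I_n -> M), forall x : M,
    exists a : 'I_n -> A, x = \sum_(i < n) a i *: e i.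

Definition mod_hom (M N : lmodType A) := {linear M -> N}.

Section ModHom.
Variables M N : lmodType A.
Implicit Types f g h : mod_hom M N.

HB.instance Definition _ := gen_eqMixin (mod_hom M N).
HB.instance Definition _ := gen_choiceMixin (mod_hom M N).

Lemma mod_homP f g : f =1 g -> f = g.
Proof.
case: f g => f [[fA] [fS]] [g [[gA] [gS]]] /= /funext fg; subst g.
by rewrite (Prop_irrelevance fA gA) (Prop_irrelevance fS gS).
Qed.

Definition mod_hom_zero : mod_hom M N := \0.
Definition mod_hom_opp f : mod_hom M N := \- f.
Definition mod_hom_add f g : mod_hom M N := f \+ g.

(* The k-module structure on an A-module is x |-> alg_map A c *: x. *)
Definition mod_hom_scale_fun (c : k) f (x : M) : N := alg_map A c *: f x.

Fact mod_hom_scale_subproof (c : k) f : linear (mod_hom_scale_fun c f).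
Proof.
move=> a x y; rewrite /mod_hom_scale_fun linearP scalerDr; congr (_ + _).
by rewrite !scalerA alg_central.
Qed.

HB.instance Definition _ (c : k) f := GRing.isLinear.Build A M N *:%R
  (mod_hom_scale_fun c f) (mod_hom_scale_subproof c f).

Definition mod_hom_scale (c : k) f : mod_hom M N := mod_hom_scale_fun c f.

Fact mod_hom_addA : associative mod_hom_add.
Proof. by move=> f g h; apply: mod_homP => x /=; rewrite addrA. Qed.
Fact mod_hom_addC : commutative mod_hom_add.
Proof. by move=> f g; apply: mod_homP => x /=; rewrite addrC. Qed.
Fact mod_hom_add0 : left_id mod_hom_zero mod_hom_add.
Proof. by move=> f; apply: mod_homP => x /=; rewrite add0r. Qed.
Fact mod_hom_addN : left_inverse mod_hom_zero mod_hom_opp mod_hom_add.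
Proof. by move=> f; apply: mod_homP => x /=; rewrite addNr. Qed.

HB.instance Definition _ := GRing.isZmodule.Build (mod_hom M N)
  mod_hom_addA mod_hom_addC mod_hom_add0 mod_hom_addN.

Fact mod_hom_scaleA (c d : k) f :
  mod_hom_scale c (mod_hom_scale d f) = mod_hom_scale (c * d) f.
Proof.
by apply: mod_homP => x; rewrite /= /mod_hom_scale_fun scalerA rmorphM.
Qed.
Fact mod_hom_scale1 : left_id 1 mod_hom_scale.
Proof.
by move=> f; apply: mod_homP => x; 
  rewrite /= /mod_hom_scale_fun rmorph1 scale1r. Qed.
Fact mod_hom_scaleDr : right_distributive mod_hom_scale +%R.
Proof.
by move=> c f g; apply: mod_homP => x; 
  rewrite /= /mod_hom_scale_fun scalerDr. Qed.
Fact mod_hom_scaleDl f : {morph mod_hom_scale^~ f : c d / c + d}.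
Proof.
by move=> c d; apply: mod_homP => x; 
  rewrite /= /mod_hom_scale_fun rmorphD scalerDl. Qed.

HB.instance Definition _ := GRing.Zmodule_isLmodule.Build k (mod_hom M N)
  mod_hom_scaleA mod_hom_scale1 mod_hom_scaleDr mod_hom_scaleDl.

End ModHom.

Record fgmod := FgMod {
  fgmod_sort :> lmodType A;
  fgmod_fg : finitely_generated fgmod_sort
}.

Program Definition Mod : lincat k :=
  @LinCat k fgmod (fun M N => mod_hom M N) (fun M => idfun)
    (fun M N P (f : mod_hom N P) (g : mod_hom M N) => f \o g)
    _ _ _ _ _ _ _.
Next Obligation. by move=> *; apply: mod_homP. Qed.
Next Obligation. by move=> *; apply: mod_homP. Qed.
Next Obligation. by move=> *; apply: mod_homP. Qed.
Next Obligation. by move=> *; apply: mod_homP. Qed.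
Next Obligation. by move=> *; apply: mod_homP => x /=; rewrite linearD. Qed.
Next Obligation. by move=> *; apply: mod_homP. Qed.
Next Obligation.
by move=> *; apply: mod_homP => x; 
  rewrite /= /mod_hom_scale_fun linearZ. Qed.

End ModuleCategory.

(* The endomorphism algebra of an object, with f * g := f \oc g. *)
Section Endomorphisms.
Variables (k : comNzRingType) (C : lincat k) (X : C).

Definition endo : Type := mor X X.
HB.instance Definition _ := GRing.Lmodule.on endo.

Definition endo_mul (f g : endo) : endo := mcomp f g.

Fact endo_mulA : associative endo_mul.
Proof. by move=> f g h; apply: mcompA. Qed.
Fact endo_mul1l : left_id (idm X : endo) endo_mul.
Proof. by move=> f; apply: mcomp1m. Qed.
Fact endo_mul1r : right_id (idm X : endo) endo_mul.
Proof. by move=> f; apply: mcompm1. Qed.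
Fact endo_mulDl : left_distributive endo_mul +%R.
Proof. by move=> f g h; apply: mcompDl. Qed.
Fact endo_mulDr : right_distributive endo_mul +%R.
Proof. by move=> f g h; apply: mcompDr. Qed.

HB.instance Definition _ := GRing.Zmodule_isPzRing.Build endo
  endo_mulA endo_mul1l endo_mul1r endo_mulDl endo_mulDr.

Definition endo_map (c : k) : endo := c *: (1 : endo).

Fact endo_map_additive : zmod_morphism endo_map.
Proof. by move=> c d; apply: scalerBl. Qed.
Fact endo_map_monoid : monoid_morphism endo_map.
Proof.
split=> [|c d]; first exact: scale1r.
rewrite /endo_map -scalerA; symmetry.
by rewrite [LHS]mcompZl [X in _ *: X]mcomp1m.
Qed.
HB.instance Definition _ := GRing.isZmodMorphism.Build k endo endo_map
  endo_map_additive.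
HB.instance Definition _ := GRing.isMonoidMorphism.Build k endo endo_map
  endo_map_monoid.

Fact endo_map_central (c : k) (f : endo) : endo_map c * f = f * endo_map c.
Proof. by rewrite [LHS]mcompZl [RHS]mcompZr [in LHS]mcomp1m [in RHS]mcompm1. Qed.

Definition End : kalgebra k :=
  @KAlgebra k endo endo_map endo_map_central.

End Endomorphisms.

Section RepresentationCategory.
Variables (k : comNzRingType) (A : kalgebra k) (C : lincat k).

Record rep := MkRep {
  rep_ob :> C;
  rep_act : kalgebra_hom A (End rep_ob)
}.

Section RepHom.
Variables M N : rep.

Definition intertwines (f : mor M N) : Prop :=
  forall a : A, f \oc rep_act M a = rep_act N a \oc f.

Definition rep_hom_pred : pred (mor M N) := fun f => `[< intertwines f >].

Fact rep_hom_pred_closed : submod_closed rep_hom_pred.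
Proof.
split=> [|c f g /asboolP fP /asboolP gP]; apply/asboolP => a.
  by rewrite mcomp0m mcompm0.
by rewrite mcompDl mcompDr mcompZl mcompZr fP gP.
Qed.

HB.instance Definition _ := GRing.isSubmodClosed.Build k (mor M N)
  rep_hom_pred rep_hom_pred_closed.

Record rep_hom := RepHom {
  rep_hom_val : mor M N;
  rep_homP : rep_hom_val \in rep_hom_pred
}.

HB.instance Definition _ := [isSub for rep_hom_val].
HB.instance Definition _ := [Choice of rep_hom by <:].
HB.instance Definition _ := [SubChoice_isSubLmodule of rep_hom by <:].

End RepHom.

Fact rep_id_subproof (M : rep) : idm M \in @rep_hom_pred M M.
Proof. by apply/asboolP => a; rewrite mcomp1m mcompm1. Qed.

Fact rep_comp_subproof (M N P : rep) (f : rep_hom N P) (g : rep_hom M N) :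
  rep_hom_val f \oc rep_hom_val g \in @rep_hom_pred M P.
Proof.
case: f g => f fP0 [g gP0] /=.
move: fP0 gP0 => /asboolP fP /asboolP gP; apply/asboolP => a.
by rewrite -mcompA gP !mcompA fP.
Qed.

Program Definition Rep : lincat k :=
  @LinCat k rep (fun M N => rep_hom M N)
    (fun M => RepHom (rep_id_subproof M))
    (fun M N P f g => RepHom (rep_comp_subproof f g))
    _ _ _ _ _ _ _.
Next Obligation. by move=> *; apply: val_inj; apply: mcomp1m. Qed.
Next Obligation. by move=> *; apply: val_inj; apply: mcompm1. Qed.
Next Obligation. by move=> *; apply: val_inj; apply: mcompA. Qed.
Next Obligation. by move=> *; apply: val_inj; apply: mcompDl. Qed.
Next Obligation. by move=> *; apply: val_inj; apply: mcompDr. Qed.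
Next Obligation. by move=> *; apply: val_inj; apply: mcompZl. Qed.
Next Obligation. by move=> *; apply: val_inj; apply: mcompZr. Qed.

End RepresentationCategory.

(* Main.v *)
Require Import Defs.
From HB Require Import structures.
From mathcomp Require Import all_boot all_order all_algebra.
From mathcomp Require Import generic_quotient ring_quotient.
From mathcomp Require Import boolp.

(* From Rep to Mod: for the abelian category of all k-modules, Rep(A, k-MOD) is
   the category of all left A-modules. An equivalence between the categories of
   all modules preserves finite generation: a module is the directed union of
   its finitely generated submodules, and an equivalence transports this union.

   From Mod to Rep: let a = A and let p in Mod(A) correspond to A'. Since A' is
   projective and a generator in Mod(A'), p is a direct summand of a finite
   power of a and conversely. Let E be the opposite of the full subcategory of
   Mod(A) on a and p, so that End_E(a) = A and End_E(p) = A'. For C abelian,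
   restriction to a is an equivalence from linear functors E -> C to Rep(A, C):
   a natural transformation is determined by its component at a, and a
   representation X extends to p as the image of an idempotent of a power of X.
   The same holds for restriction to p. *)

Set Implicit Arguments.
Unset Strict Implicit.
Unset Printing Implicit Defensive.
#[local] Obligation Tactic := idtac.

Import GRing.Theory.
Local Open Scope ring_scope.

(** * Linear categories and equivalences *)

Section LinCatTheory.
Variable k : comNzRingType.

Lemma mcompNl (C : lincat k) (X Y Z : C) (f : mor Y Z) (g : mor X Y) :
  (- f) \oc g = - (f \oc g).
Proof. by rewrite -scaleN1r mcompZl scaleN1r. Qed.

Lemma mcomp_suml (C : lincat k) (X Y Z : C) (I : Type) (r : seq I) (P : pred I)
    (F : I -> mor Y Z) (g : mor X Y) :
  (\sum_(i <- r | P i) F i) \oc g = \sum_(i <- r | P i) F i \oc g.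
Proof.
by apply: (big_morph (fun f => f \oc g)) => [f h|]; rewrite ?mcompDl ?mcomp0m.
Qed.

Lemma mcomp_sumr (C : lincat k) (X Y Z : C) (I : Type) (r : seq I) (P : pred I)
    (F : I -> mor X Y) (g : mor Y Z) :
  g \oc (\sum_(i <- r | P i) F i) = \sum_(i <- r | P i) g \oc F i.
Proof.
by apply: (big_morph (fun f => g \oc f)) => [f h|]; rewrite ?mcompDr ?mcompm0.
Qed.

Lemma is_iso_comp (C : lincat k) (X Y Z : C) (f : mor Y Z) (g : mor X Y) :
  is_iso f -> is_iso g -> is_iso (f \oc g).
Proof.
move=> [f' [f1 f2]] [g' [g1 g2]]; exists (g' \oc f'); split.
  by rewrite mcompA -(mcompA g') f1 mcompm1.
by rewrite mcompA -(mcompA f) g2 mcompm1.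
Qed.

Lemma is_iso_fhom (C D : lincat k) (F : linfunctor C D) (X Y : C)
    (f : mor X Y) : is_iso f -> is_iso (fhom F f).
Proof. by move=> [g [gf fg]]; exists (fhom F g); rewrite -!fhomM gf fg !fhom1. Qed.

Definition full (C D : lincat k) (F : linfunctor C D) :=
  forall (X Y : C) (g : mor (F X) (F Y)), exists f : mor X Y, fhom F f = g.

Definition faithful (C D : lincat k) (F : linfunctor C D) :=
  forall X Y : C, injective (fhom F : mor X Y -> _).

Definition ess_surj (C D : lincat k) (F : linfunctor C D) :=
  forall Y : D, exists (X : C) (f : mor (F X) Y), is_iso f.

(** * Quasi-inverse of a fully faithful, essentially surjective functor *)

Section InverseFunctor.
Variables (C D : lincat k) (F : linfunctor C D).
Hypotheses (F_full : full F) (F_faithful : faithful F).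
Variables (G : D -> C) (e : forall Y, mor (F (G Y)) Y)
  (e' : forall Y, mor Y (F (G Y))).
Hypotheses (e'e : forall Y, e' Y \oc e Y = idm _)
  (ee' : forall Y, e Y \oc e' Y = idm _).

(** The preimage is picked by choice, but faithfulness makes it unique, which forces linearity and
    functoriality. *)
Definition inv_hom (Y Z : D) (g : mor Y Z) : mor (G Y) (G Z) :=
  projT1 (cid (F_full (e' Z \oc g \oc e Y))).

Lemma inv_homK (Y Z : D) (g : mor Y Z) :
  fhom F (inv_hom g) = e' Z \oc g \oc e Y.
Proof. by rewrite /inv_hom; case: cid. Qed.

Fact inv_hom_linear (Y Z : D) : linear (@inv_hom Y Z).
Proof.
move=> c g h; apply: F_faithful.
by rewrite linearP !inv_homK mcompDr mcompDl mcompZr mcompZl.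
Qed.

HB.instance Definition _ (Y Z : D) :=
  GRing.isLinear.Build k (mor Y Z) (mor (G Y) (G Z)) *:%R
    (@inv_hom Y Z) (@inv_hom_linear Y Z).

Program Definition inv_functor : linfunctor D C :=
  @LinFunctor k D C G (fun Y Z => @inv_hom Y Z) _ _.
Next Obligation.
by move=> Y; apply: F_faithful; rewrite inv_homK mcompm1 e'e fhom1.
Qed.
Next Obligation.
move=> X Y Z f g; apply: F_faithful; rewrite fhomM !inv_homK !mcompA.
by congr (_ \oc _ \oc _); rewrite -!mcompA ee' mcompm1.
Qed.

End InverseFunctor.

Lemma lin_equivalent_ff (C D : lincat k) (F : linfunctor C D) :
  full F -> faithful F -> ess_surj F -> lin_equivalent C D.
Proof.
move=> Ff Fi Fs.
pose G Y := projT1 (cid (Fs Y)).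
pose e Y : mor (F (G Y)) Y := projT1 (cid (projT2 (cid (Fs Y)))).
pose e'P Y := cid (projT2 (cid (projT2 (cid (Fs Y))))).
pose e' Y : mor Y (F (G Y)) := projT1 (e'P Y).
have e'e Y : e' Y \oc e Y = idm _ by case: (projT2 (e'P Y)).
have e_e' Y : e Y \oc e' Y = idm _ by case: (projT2 (e'P Y)).
(* A fully faithful functor reflects isomorphisms; hence the lift [eta] of [e] below is
   invertible. *)
have Fiso X Y (f : mor X Y) : is_iso (fhom F f) -> is_iso f.
  move=> [g [gf fg]]; have [g' g'E] := Ff _ _ g; exists g'.
  by split; apply: Fi; rewrite fhomM fhom1 g'E.
exists F, (inv_functor Ff Fi e'e e_e'); split.
  pose eta X : mor (G (F X)) X := projT1 (cid (Ff _ _ (e (F X)))).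
  have etaE X : fhom F (eta X) = e (F X) := projT2 (cid (Ff _ _ (e (F X)))).
  have eta_iso X : is_iso (eta X) by apply: Fiso; rewrite etaE; exists (e' (F X)).
  exists eta; split=> // X Y f; apply: (Fi); rewrite [LHS]fhomM [RHS]fhomM.
  by rewrite [fhom F (eta Y)]etaE [fhom F (eta X)]etaE inv_homK !mcompA e_e' mcomp1m.
have e_iso Y : is_iso (e Y) by exists (e' Y); split; [apply: e'e|apply: e_e'].
by exists e; split=> // X Y f; rewrite /= inv_homK !mcompA e_e' mcomp1m.
Qed.

Section EquivalenceFunctor.
Variables (C D : lincat k) (F : linfunctor C D) (G : linfunctor D C).

Lemma nat_iso_faithful : nat_iso (comp_functor G F) (id_functor C) -> faithful F.
Proof.
move=> [eta [eta_iso etaN]] X Y f g fg.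
have [e' [e'e ee']] := eta_iso X.
have : eta Y \oc fhom G (fhom F f) = eta Y \oc fhom G (fhom F g) by rewrite fg.
rewrite [LHS]etaN [RHS]etaN /= => /(congr1 (fun h => h \oc e')).
by rewrite -!mcompA ee' !mcompm1.
Qed.

(** The preimage of [g] is [G g] conjugated by [eta]. Naturality of [eta] shows that [G] does not
    distinguish its image under [F] from [g]. *)
Lemma nat_iso_full : nat_iso (comp_functor G F) (id_functor C) ->
  faithful G -> full F.
Proof.
move=> [eta [eta_iso etaN]] Gf X Y g.
have [e' [e'e ee']] := eta_iso X.
exists (eta Y \oc fhom G g \oc e'); apply: Gf.
have [y' [y'e ye']] := eta_iso Y.
suff /(congr1 (fun h => y' \oc h)) :
    eta Y \oc fhom G (fhom F (eta Y \oc fhom G g \oc e')) = eta Y \oc fhom G g by rewrite !mcompA y'e !mcomp1m.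
by rewrite [LHS]etaN /= -!mcompA e'e mcompm1.
Qed.

Lemma nat_iso_ess_surj : nat_iso (comp_functor F G) (id_functor D) -> ess_surj F.
Proof. by move=> [eta [eta_iso _]] Y; exists (G Y), (eta Y); exact: eta_iso. Qed.

End EquivalenceFunctor.

Lemma lin_equivalentP (C D : lincat k) : lin_equivalent C D <->
  exists F : linfunctor C D, [/\ full F, faithful F & ess_surj F].
Proof.
split=> [[F [G [GF FG]]]|[F [? ? ?]]]; last exact: (@lin_equivalent_ff _ _ F).
exists F; split; last exact: nat_iso_ess_surj FG.
  exact: nat_iso_full GF (nat_iso_faithful FG).
exact: nat_iso_faithful GF.
Qed.

Lemma lin_equivalent_sym (C D : lincat k) :
  lin_equivalent C D -> lin_equivalent D C.
Proof. by move=> [F [G [? ?]]]; exists G, F. Qed.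

Lemma lin_equivalent_trans (D C E : lincat k) :
  lin_equivalent C D -> lin_equivalent D E -> lin_equivalent C E.
Proof.
move=> /lin_equivalentP[F [Ff Fi Fs]] /lin_equivalentP[G [Gf Gi Gs]].
apply/lin_equivalentP; exists (comp_functor G F); split.
- move=> X Y h; have [g gE] := Gf _ _ h; have [f fE] := Ff _ _ g.
  by exists f; rewrite /= fE.
- by move=> X Y f g /Gi/Fi.
- move=> Z; have [Y [g g_iso]] := Gs Z; have [X [f f_iso]] := Fs Y.
  exists X, (g \oc fhom G f); apply: is_iso_comp => //; exact: is_iso_fhom.
Qed.

(** A full subcategory whose objects are labels, so different labels may share a value under [u]. It
    gives the two-object category and, with linear functors as labels, stands in for a functor
    category. *)
Definition induced_cat (C : lincat k) (O : Type) (u : O -> C) : lincat k :=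
  @LinCat k O (fun X Y => mor (u X) (u Y)) (fun X => idm (u X))
    (fun X Y Z f g => f \oc g)
    (fun X Y f => mcomp1m f) (fun X Y f => mcompm1 f)
    (fun X Y Z W f g h => mcompA f g h) (fun X Y Z f g h => mcompDl f g h)
    (fun X Y Z f g h => mcompDr f g h) (fun X Y Z c f g => mcompZl c f g)
    (fun X Y Z c f g => mcompZr c f g).

Program Definition induced_functor (C : lincat k) (O : Type) (u : O -> C) :
  linfunctor (induced_cat u) C :=
  @LinFunctor k (induced_cat u) C u (fun X Y => idfun) _ _.
Next Obligation. by []. Qed.
Next Obligation. by []. Qed.

Lemma induced_equivalent (C : lincat k) (O : Type) (u : O -> C) :
  (forall Y : C, exists (X : O) (f : mor (u X) Y), is_iso f) ->
  lin_equivalent (induced_cat u) C.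
Proof.
move=> us; apply/lin_equivalentP; exists (induced_functor u).
split=> [X Y g|X Y f g //|].
  by exists g.
exact: us.
Qed.

End LinCatTheory.

(** * Restriction of linear functors to one object *)

Section AbelianTheory.
Variables (k : comNzRingType) (C : lincat k).
Hypothesis C_ab : is_abelian C.

(** The image of [e] is built as the kernel of [idm S - e], and [q] is the factorization of [e]
    through it. *)
Lemma idempotent_split (S : C) (e : mor S S) : e \oc e = e ->
  exists (K : C) (i : mor K S) (q : mor S K), q \oc i = idm K /\ i \oc q = e.
Proof.
move=> ee; have [K [i [i0 iU]]] := ab_kernel C_ab (idm S - e).
have ei : e \oc i = i.
  by apply/esym/eqP; rewrite -subr_eq0 -mcompNl -{1}(mcomp1m i) -mcompDl i0.
have [|q [qE _]] := iU _ e; first by rewrite mcompDl mcomp1m mcompNl ee subrr.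
exists K, i, q; split=> //.
(* Both [idm K] and [q \oc i] factor [i] through itself, so uniqueness identifies them. *)
have [h [_ hU]] := iU _ i i0.
by rewrite -(hU (idm K)) ?mcompm1 // (hU (q \oc i)) // mcompA qE ei.
Qed.

Lemma power_exists (X : C) (n : nat) :
  exists (S : C) (inj : 'I_n -> mor X S) (prj : 'I_n -> mor S X),
    (forall i j, prj i \oc inj j = if i == j then idm X else 0) /\
    \sum_i inj i \oc prj i = idm S.
Proof.
elim: n => [|n [S [inj [prj [pi ip]]]]].
  have [Z Z0] := ab_zero C_ab; exists Z, (fun=> 0), (fun=> 0).
  split=> [[]//|]; rewrite big_ord0.
  by have [_ [f [_ fU]]] := Z0 Z; rewrite -(fU 0) // -(fU (idm Z)).
have [T [i1 [i2 [p1 [p2 [p1i1 p2i2 p1i2 p2i1 s]]]]]] := ab_biproduct C_ab X S.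
(* Index [ord0] is the new summand [X]; the other indices, recovered by [unlift], pass through
   [S]. *)
exists T, (fun i => oapp (fun j => i2 \oc inj j) i1 (unlift ord0 i)),
  (fun i => oapp (fun j => prj j \oc p2) p1 (unlift ord0 i)); split.
  move=> i j; case: (unliftP ord0 i) => [i' ->|->];
    case: (unliftP ord0 j) => [j' ->|->] /=; rewrite ?eqxx //.
  - rewrite (inj_eq lift_inj) -pi -mcompA (mcompA p2) p2i2 mcomp1m //.
  - by rewrite -mcompA p2i1 mcompm0.
  - by rewrite mcompA p1i2 mcomp0m.
rewrite big_ord_recl unlift_none /= -s; congr (_ + _).
under eq_bigr => i _ do rewrite liftK /= mcompA -(mcompA i2).
by rewrite -mcomp_suml -mcomp_sumr ip mcompm1.
Qed.

End AbelianTheory.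

(** * Direct summands of powers and extension of equivariant morphisms *)

Section Retractions.
Variables (k : comNzRingType).

(* [c] is a direct summand of [b ^ rt_n], without referring to direct sums. *)
Record retraction (E : lincat k) (c b : E) := Retraction {
  rt_n : nat;
  rt_r : 'I_rt_n -> mor b c;
  rt_s : 'I_rt_n -> mor c b;
  rt_rs : \sum_i rt_r i \oc rt_s i = idm c
}.

Arguments rt_r {E c b}.
Arguments rt_s {E c b}.

Lemma id_retraction_subproof (E : lincat k) (b : E) :
  \sum_(i < 1) idm b \oc idm b = idm b.
Proof. by rewrite big_ord1 mcomp1m. Qed.

Definition id_retraction (E : lincat k) (b : E) : retraction b b :=
  Retraction (id_retraction_subproof b).

Section Extension.
Variables (E C : lincat k) (b : E).

Definition equivariant (M N : linfunctor E C) (f : mor (M b) (N b)) :=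
  forall x : mor b b, f \oc fhom M x = fhom N x \oc f.

(** A natural transformation with component [f] at [b] must have this component at [c]: insert
    [\sum_i r_i \oc s_i = idm c] and use naturality. *)
Definition extend (c : E) (rt : retraction c b) (M N : linfunctor E C)
    (f : mor (M b) (N b)) : mor (M c) (N c) :=
  \sum_i fhom N (rt_r rt i) \oc f \oc fhom M (rt_s rt i).

Lemma fhom_rt (c : E) (rt : retraction c b) (M : linfunctor E C) :
  \sum_i fhom M (rt_r rt i) \oc fhom M (rt_s rt i) = idm (M c).
Proof.
by rewrite -fhom1 -(rt_rs rt) linear_sum; apply: eq_bigr => i _; rewrite fhomM.
Qed.

(** Each [p \oc r_i] is an endomorphism of [b], so equivariance moves it across [f]; then
    [\sum_i r_i \oc s_i = idm c] collapses the sum. *)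
Lemma extend_natl (c : E) (rt : retraction c b) (M N : linfunctor E C)
    (f : mor (M b) (N b)) (p : mor c b) :
  equivariant f -> fhom N p \oc extend rt f = f \oc fhom M p.
Proof.
move=> fE; rewrite /extend mcomp_sumr.
under eq_bigr => i _ do rewrite !mcompA -fhomM -fE fhomM -!mcompA.
by rewrite -mcomp_sumr -mcomp_sumr fhom_rt mcompm1.
Qed.

(** Naturality along the maps [r_i] alone determines the component at [c]. Identities for [extend]
    can thus be proved without handling sums. *)
Lemma extend_unique (c : E) (rt : retraction c b) (M N : linfunctor E C)
    (f : mor (M b) (N b)) (g : mor (M c) (N c)) :
  (forall p : mor b c, g \oc fhom M p = fhom N p \oc f) -> extend rt f = g.
Proof.
move=> gf; rewrite /extend.
under eq_bigr => i _ do rewrite -gf -mcompA.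
by rewrite -mcomp_sumr fhom_rt mcompm1.
Qed.

Lemma extend1 (c : E) (rt : retraction c b) (M : linfunctor E C) :
  extend rt (idm (M b)) = idm (M c).
Proof. by apply: extend_unique => p; rewrite mcomp1m mcompm1. Qed.

Lemma extendM (c : E) (rt : retraction c b) (M N P : linfunctor E C)
    (f : mor (N b) (P b)) (g : mor (M b) (N b)) : equivariant g ->
  extend rt (f \oc g) = extend rt f \oc extend rt g.
Proof.
move=> gE; rewrite /extend mcomp_suml; apply: eq_bigr => i _.
by rewrite -[RHS]mcompA extend_natl // !mcompA.
Qed.

Lemma extend_linear (c : E) (rt : retraction c b) (M N : linfunctor E C) :
  linear (@extend c rt M N).
Proof.
move=> x f g; rewrite /extend scaler_sumr -big_split; apply: eq_bigr => i _ /=.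
by rewrite mcompDr mcompDl mcompZr mcompZl.
Qed.

End Extension.

Lemma extend_equivariant (E C : lincat k) (b c : E) (rt : retraction c b)
    (M N : linfunctor E C) (f : mor (M b) (N b)) :
  equivariant f -> equivariant (extend rt f).
Proof.
move=> fE x; rewrite {1}/extend mcomp_suml.
(* Each [s_i \oc x] is a morphism [c -> b], so [extend_natl] trades [f] on its left for
   [extend rt f] on its right. *)
under eq_bigr => i _ do
  rewrite -mcompA -fhomM -mcompA -(extend_natl rt _ fE) fhomM -mcompA mcompA.
by rewrite -mcomp_suml fhom_rt mcomp1m.
Qed.

(** By [extend_natl], [f] and [extend rt f] are compatible with every map [c -> b]; this is the
    condition that characterizes the extension back to [b]. *)
Lemma extendK (E C : lincat k) (b c : E) (rt : retraction c b)
    (rt' : retraction b c) (M N : linfunctor E C) (f : mor (M b) (N b)) :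
  equivariant f -> extend rt' (extend rt f) = f.
Proof. by move=> fE; apply: extend_unique => p; rewrite extend_natl. Qed.

End Retractions.
Arguments rt_r {k E c b}.
Arguments rt_s {k E c b}.

Section Restriction.
Variables (k : comNzRingType) (E C : lincat k) (R : kalgebra k) (b : E).
Variable al : kalgebra_hom R (End b).

Section Act.
Variable M : linfunctor E C.

Definition res_fun (x : R) : End (M b) := fhom M (al x : mor b b).

Fact res_fun_additive : zmod_morphism res_fun.
Proof. by move=> x y; rewrite /res_fun rmorphB linearB. Qed.
Fact res_fun_monoid : monoid_morphism res_fun.
Proof.
split; first by rewrite /res_fun rmorph1; apply: fhom1.
by move=> x y; rewrite /res_fun rmorphM; apply: fhomM.
Qed.
HB.instance Definition _ := GRing.isZmodMorphism.Build R (End (M b)) res_fun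
  res_fun_additive.
HB.instance Definition _ := GRing.isMonoidMorphism.Build R (End (M b)) res_fun
  res_fun_monoid.

Fact res_fun_map (c : k) : res_fun (alg_map R c) = alg_map (End (M b)) c.
Proof.
rewrite /res_fun alg_hom_map /= /endo_map linearZ; congr (_ *: _).
exact: fhom1.
Qed.

Definition restrict : Rep R C :=
  @MkRep k R C (M b) (@KAlgebraHom k R (End (M b)) res_fun res_fun_map).

End Act.

Hypothesis al_surj : forall x : mor b b, exists y, al y = x.

Lemma restrict_homP (M N : linfunctor E C) (f : mor (M b) (N b)) :
  f \in @rep_hom_pred k R C (restrict M) (restrict N) <-> equivariant f.
Proof.
split=> [/asboolP fP x|fE]; last by apply/asboolP => x; apply: fE.
by have [y <-] := al_surj x; apply: fP.
Qed.

End Restriction.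

(** * Passage from representations at one object to representations at another *)

Section ChangeBase.
Variables (k : comNzRingType) (E C : lincat k) (R S : kalgebra k) (b c : E).
Variables (al : kalgebra_hom R (End b)) (be : kalgebra_hom S (End c)).
Hypothesis al_surj : forall x : mor b b, exists y, al y = x.
Hypothesis be_surj : forall x : mor c c, exists y, be y = x.
Variables (rt : retraction c b) (rt' : retraction b c).

Notation resb := (@restrict k E C R b al).
Notation resc := (@restrict k E C S c be).

Lemma extend_subproof (M N : linfunctor E C) (f : rep_hom (resb M) (resb N)) :
  extend rt (rep_hom_val f) \in @rep_hom_pred k S C (resc M) (resc N).
Proof.
apply/(restrict_homP be_surj)/extend_equivariant/(restrict_homP al_surj).
exact: rep_homP.
Qed.

Definition extend_hom (M N : linfunctor E C) (f : rep_hom (resb M) (resb N)) :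
  rep_hom (resc M) (resc N) := RepHom (extend_subproof f).

Fact extend_hom_linear (M N : linfunctor E C) : linear (@extend_hom M N).
Proof. by move=> x f g; apply: val_inj; apply: extend_linear. Qed.

HB.instance Definition _ (M N : linfunctor E C) :=
  GRing.isLinear.Build k (rep_hom (resb M) (resb N)) (rep_hom (resc M) (resc N))
    *:%R (@extend_hom M N) (@extend_hom_linear M N).

(** A morphism [M -> N] of the source is an equivariant map [M b -> N b], standing for the natural
    transformation it extends to; the functor takes the component at [c]. *)
Program Definition change_base : linfunctor (induced_cat resb) (Rep S C) :=
  @LinFunctor k (induced_cat resb) (Rep S C) resc
    (fun M N => @extend_hom M N) _ _.
Next Obligation. by move=> M; apply: val_inj; apply: extend1. Qed.
Next Obligation.
move=> M N P f g; apply: val_inj; apply: extendM.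
by apply/(restrict_homP al_surj)/rep_homP.
Qed.

Lemma change_base_full : full change_base.
Proof.
move=> M N g.
have gE : equivariant (rep_hom_val g) by apply/(restrict_homP be_surj)/rep_homP.
have fP : extend rt' (rep_hom_val g) \in @rep_hom_pred k R C (resb M) (resb N).
  by apply/(restrict_homP al_surj)/extend_equivariant.
by exists (RepHom fP); apply: val_inj; apply: extendK.
Qed.

Lemma change_base_faithful : faithful change_base.
Proof.
move=> M N f g /(congr1 (fun h : rep_hom (resc M) (resc N) =>
  extend rt' (rep_hom_val h))) /=.
have fE : equivariant (rep_hom_val f) by apply/(restrict_homP al_surj)/rep_homP.
have gE : equivariant (rep_hom_val g) by apply/(restrict_homP al_surj)/rep_homP.
by rewrite !extendK // => ?; apply: val_inj.
Qed.

(** The linear functors, compared at [b], form an intermediate category; restriction to [b] and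
    [change_base] are both equivalences out of it. *)
Lemma change_base_equivalent :
  (forall X : Rep R C, exists (M : linfunctor E C) (f : mor (resb M) X), is_iso f) ->
  (forall X : Rep S C, exists (M : linfunctor E C) (f : mor (resc M) X), is_iso f) ->
  lin_equivalent (Rep R C) (Rep S C).
Proof.
move=> sb sc; apply: (@lin_equivalent_trans _ (induced_cat resb)).
  exact/lin_equivalent_sym/induced_equivalent.
apply/lin_equivalentP; exists change_base; split.
- exact: change_base_full.
- exact: change_base_faithful.
- exact: sc.
Qed.

End ChangeBase.

(** * Extension of a representation at [b] to a linear functor *)

Section Induction.
Variables (k : comNzRingType) (E C : lincat k) (R : kalgebra k) (b : E).
Variables (al : kalgebra_hom R (End b)) (be : mor b b -> R).
Hypotheses (alK : cancel al be) (beK : cancel be al).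
Variable X : rep R C.

Definition end_act (x : mor b b) : mor X X := rep_act X (be x).

Lemma end_act1 : end_act (idm b) = idm X.
Proof.
by rewrite /end_act -[idm b](rmorph1 al) alK rmorph1.
Qed.

Lemma end_actM (x y : mor b b) : end_act (x \oc y) = end_act x \oc end_act y.
Proof.
have xy : x \oc y = al (be x * be y) by rewrite rmorphM !beK.
by rewrite /end_act xy alK rmorphM.
Qed.

Fact end_act_linear : linear end_act.
Proof.
move=> c x y; rewrite /end_act.
have -> : c *: x + y = al (alg_map R c * be x + be y).
  rewrite rmorphD rmorphM alg_hom_map !beK; congr (_ + _).
  by rewrite [RHS]mcompZl mcomp1m.
rewrite alK rmorphD rmorphM alg_hom_map; congr (_ + _).
by rewrite [LHS]mcompZl mcomp1m.
Qed.

HB.instance Definition _ := GRing.isLinear.Build k (mor b b) (mor X X) *:%R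
  end_act end_act_linear.

(** A candidate for the value at [c]: the summand of a power of [X] cut out by the idempotent matrix
    with entries [s_i \oc r_j]. The [ch_u] are the coordinates of its inclusion and the [ch_v] those
    of its projection. *)
Record chart (c : E) := Chart {
  ch_rt :> retraction c b;
  ch_ob : C;
  ch_u : 'I_(rt_n ch_rt) -> mor ch_ob X;
  ch_v : 'I_(rt_n ch_rt) -> mor X ch_ob;
  ch_vu : \sum_i ch_v i \oc ch_u i = idm ch_ob;
  ch_uv : forall i j, ch_u i \oc ch_v j = end_act (rt_s ch_rt i \oc rt_r ch_rt j)
}.
Arguments ch_u {c}.
Arguments ch_v {c}.

Lemma id_chart_vu : \sum_(i < 1) idm X \oc idm X = idm X.
Proof. by rewrite big_ord1 mcomp1m. Qed.

Lemma id_chart_uv (i j : 'I_1) : idm X \oc idm X = end_act (idm b \oc idm b).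
Proof. by rewrite !mcomp1m end_act1. Qed.

Definition id_chart : chart b :=
  @Chart b (id_retraction b) X _ _ id_chart_vu id_chart_uv.

(** The entries [s_j \oc p \oc r_i] form the matrix of [p] over the endomorphisms of [b]; it acts
    between powers of [X] and is cut down to the two summands. *)
Definition trans (c d : E) (s : chart c) (t : chart d) (p : mor c d) :
    mor (ch_ob s) (ch_ob t) :=
  \sum_j \sum_i ch_v t j \oc end_act (rt_s t j \oc p \oc rt_r s i) \oc ch_u s i.

Fact trans_linear (c d : E) (s : chart c) (t : chart d) : linear (trans s t).
Proof.
move=> x p q; rewrite /trans scaler_sumr -big_split; apply: eq_bigr => j _ /=.
rewrite scaler_sumr -big_split; apply: eq_bigr => i _ /=.
by rewrite mcompDr mcompDl mcompZr mcompZl linearP mcompDr mcompDl mcompZr mcompZl.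
Qed.

HB.instance Definition _ (c d : E) (s : chart c) (t : chart d) :=
  GRing.isLinear.Build k (mor c d) (mor (ch_ob s) (ch_ob t)) *:%R
    (trans s t) (trans_linear s t).

Lemma trans1 (c : E) (s : chart c) : trans s s (idm c) = idm (ch_ob s).
Proof.
rewrite /trans -[RHS]mcomp1m -{1}(ch_vu s) mcomp_suml; apply: eq_bigr => j _.
rewrite -(ch_vu s) mcomp_sumr; apply: eq_bigr => i _.
by rewrite mcompm1 -ch_uv !mcompA.
Qed.

Lemma sum_end_act (c : E) (rt : retraction c b) (x : mor c b) (y : mor b c) :
  \sum_i end_act (x \oc rt_r rt i) \oc end_act (rt_s rt i \oc y) = end_act (x \oc y).
Proof.
under eq_bigr => i _ do rewrite -end_actM mcompA -(mcompA x).
by rewrite -linear_sum -mcomp_suml -mcomp_sumr rt_rs mcompm1.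
Qed.

(** The products [u_l \oc v_j] form the idempotent matrix of [d], which the matrix of [p] absorbs by
    [sum_end_act]. *)
Lemma ch_u_trans (c d : E) (s : chart c) (t : chart d) (p : mor c d) l :
  ch_u t l \oc trans s t p = \sum_i end_act (rt_s t l \oc p \oc rt_r s i) \oc ch_u s i.
Proof.
rewrite /trans exchange_big mcomp_sumr; apply: eq_bigr => i _ /=.
rewrite mcomp_sumr -mcompA -(sum_end_act t) mcomp_suml; apply: eq_bigr => m _.
by rewrite !mcompA ch_uv.
Qed.

Lemma transM (c d e : E) (s : chart c) (t : chart d) (u : chart e)
    (q : mor d e) (p : mor c d) :
  trans s u (q \oc p) = trans t u q \oc trans s t p.
Proof.
rewrite {1 2}/trans mcomp_suml; apply: eq_bigr => j _.
rewrite mcomp_suml.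
under [RHS]eq_bigr => l _ do rewrite -mcompA ch_u_trans mcomp_sumr.
rewrite exchange_big; apply: eq_bigr => i _ /=.
rewrite mcompA -(mcompA _ p) -(sum_end_act t) mcomp_sumr mcomp_suml.
by apply: eq_bigr => l _; rewrite !mcompA.
Qed.

Lemma trans_id_chart (x : mor b b) : trans id_chart id_chart x = end_act x.
Proof. by rewrite /trans !big_ord1 /= !mcomp1m !mcompm1. Qed.

Section Functor.
Variable s : forall c : E, chart c.

Program Definition induction : linfunctor E C :=
  @LinFunctor k E C (fun c => ch_ob (s c)) (fun c d => trans (s c) (s d)) _ _.
Next Obligation. by move=> c; apply: trans1. Qed.
Next Obligation. by move=> *; apply: transM. Qed.

(** The chart chosen at [b] may differ from [id_chart], whose object is [X]. The transition maps of
    [idm b] between the two charts are equivariant and mutually inverse by [transM]. *)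
Lemma restrict_induction :
  exists f : mor (restrict al induction : Rep R C) X, is_iso f.
Proof.
have actE x : rep_act X x = trans id_chart id_chart (al x).
  by rewrite trans_id_chart /end_act alK.
have fP : trans (s b) id_chart (idm b) \in
    @rep_hom_pred k R C (restrict al induction) X.
  apply/asboolP => x; rewrite actE.
  have e1 := transM (s b) (s b) id_chart (idm b) (al x).
  have e2 := transM (s b) id_chart id_chart (al x) (idm b).
  by move: e1 e2; rewrite mcomp1m mcompm1 => e1 e2; apply: etrans (esym e1) e2.
have gP : trans id_chart (s b) (idm b) \in
    @rep_hom_pred k R C X (restrict al induction).
  apply/asboolP => x; rewrite actE.
  have e1 := transM id_chart id_chart (s b) (idm b) (al x).
  have e2 := transM id_chart (s b) (s b) (al x) (idm b).
  by move: e1 e2; rewrite mcomp1m mcompm1 => e1 e2; apply: etrans (esym e1) e2.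
exists (RepHom fP), (RepHom gP); split; apply: val_inj => /=.
  by have := transM (s b) id_chart (s b) (idm b) (idm b); rewrite mcomp1m trans1.
by have := transM id_chart (s b) id_chart (idm b) (idm b); rewrite mcomp1m trans1.
Qed.

End Functor.

Lemma chart_exists (c : E) : is_abelian C -> retraction c b ->
  inhabited (chart c).
Proof.
move=> C_ab rt.
have [S [inj [prj [pi ip]]]] := power_exists C_ab X (rt_n rt).
(* This matrix is idempotent because [\sum_j r_j \oc s_j = idm c]; its image will be the object of
   the chart. *)
pose e : mor S S :=
  \sum_i \sum_j inj i \oc end_act (rt_s rt i \oc rt_r rt j) \oc prj j.
have pe i : prj i \oc e = \sum_j end_act (rt_s rt i \oc rt_r rt j) \oc prj j.
  rewrite /e mcomp_sumr (bigD1 i) //= [X in _ + X]big1 ?addr0 => [|j ji].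
    by rewrite mcomp_sumr; apply: eq_bigr => l _; rewrite !mcompA pi eqxx mcomp1m.
  by rewrite mcomp_sumr big1 // => l _; rewrite !mcompA pi eq_sym (negPf ji) !mcomp0m.
have ei j : e \oc inj j = \sum_i inj i \oc end_act (rt_s rt i \oc rt_r rt j).
  rewrite /e mcomp_suml; apply: eq_bigr => i _.
  rewrite mcomp_suml (bigD1 j) //= [X in _ + X]big1 ?addr0 => [|l lj].
    by rewrite -!mcompA pi eqxx mcompm1.
  by rewrite -!mcompA pi (negPf lj) !mcompm0.
have ee : e \oc e = e.
  rewrite {1}/e mcomp_suml; apply: eq_bigr => i _.
  rewrite mcomp_suml.
  under eq_bigr => j _ do rewrite -mcompA pe mcomp_sumr.
  rewrite exchange_big /=; apply: eq_bigr => l _.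
  under eq_bigr => j _ do rewrite mcompA -(mcompA (inj i)).
  by rewrite -mcomp_suml -mcomp_sumr sum_end_act.
have [K [i [q [qi iq]]]] := idempotent_split C_ab ee.
have uv l j : prj l \oc i \oc (q \oc inj j) = end_act (rt_s rt l \oc rt_r rt j).
  rewrite mcompA -(mcompA (prj l)) iq pe mcomp_suml (bigD1 j) //=.
  rewrite [X in _ + X]big1 ?addr0 => [|m mj].
    by rewrite -mcompA pi eqxx mcompm1.
  by rewrite -mcompA pi (negPf mj) mcompm0.
have vu : \sum_j (q \oc inj j) \oc (prj j \oc i) = idm K.
  under eq_bigr => j _ do rewrite mcompA -(mcompA q).
  by rewrite -mcomp_suml -mcomp_sumr ip mcompm1.
by split; apply: Chart vu uv.
Qed.

End Induction.

Lemma restrict_ess_surj (k : comNzRingType) (E C : lincat k) (R : kalgebra k)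
    (b : E) (al : kalgebra_hom R (End b)) :
  is_abelian C -> bijective al -> (forall c : E, inhabited (retraction c b)) ->
  forall X : Rep R C, exists (M : linfunctor E C)
    (f : mor (restrict al M : Rep R C) X), is_iso f.
Proof.
move=> C_ab [be alK beK] rt X.
have ch c : exists s : chart be X c, True.
  by have [r] := rt c; have [s] := chart_exists alK beK X C_ab r; exists s.
by exists (induction alK beK (fun c => projT1 (cid (ch c)))); apply: restrict_induction.
Qed.

(** * Submodules, quotient modules and the category of all modules *)

Section SubQuotient.
Variables (A : pzRingType) (M : lmodType A) (U : M -> Prop).
Hypotheses (U0 : U 0) (UP : forall a x y, U x -> U y -> U (a *: x + y)).

Definition submod_pred : {pred M} := fun x => `[< U x >].

Fact submod_pred_closed : submod_closed submod_pred.
Proof.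
by split=> [|a x y /asboolP xU /asboolP yU]; apply/asboolP=> //; apply: UP.
Qed.

Fact submod_pred_oppr : oppr_closed submod_pred.
Proof.
move=> x /asboolP xU; apply/asboolP.
by rewrite -scaleN1r -[X in U X]addr0; apply: UP.
Qed.

HB.instance Definition _ := GRing.isSubmodClosed.Build A M
  submod_pred submod_pred_closed.
HB.instance Definition _ := GRing.isOppClosed.Build M
  submod_pred submod_pred_oppr.

Record submod := Submod { submod_val : M; submodP : submod_val \in submod_pred }.

HB.instance Definition _ := [isSub for submod_val].
HB.instance Definition _ := [Choice of submod by <:].
HB.instance Definition _ := [SubChoice_isSubLmodule of submod by <:].

Definition quotmod := Quotient.quot submod_pred.

HB.instance Definition _ := GRing.Zmodule.on quotmod.

Local Open Scope quotient_scope.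

Definition quotmod_pi : M -> quotmod := \pi_quotmod.

Fact quotmod_pi_additive : zmod_morphism quotmod_pi.
Proof. by move=> x y; rewrite /quotmod_pi !piE. Qed.

HB.instance Definition _ := GRing.isZmodMorphism.Build M quotmod quotmod_pi
  quotmod_pi_additive.

Lemma quotmod_piE x y : quotmod_pi x = quotmod_pi y <-> U (x - y).
Proof.
split=> [/eqP|xy]; first by rewrite -Quotient.idealrBE => /asboolP.
by apply/eqP; rewrite -Quotient.idealrBE; apply/asboolP.
Qed.

Lemma quotmod_surj (y : quotmod) : exists x, quotmod_pi x = y.
Proof. by exists (repr y); apply: reprK. Qed.

(** The quotient is so far an additive group only. The action is defined on representatives, and
    [quotmod_scaleE] gives independence of their choice. *)
Definition quotmod_scale (a : A) (x : quotmod) : quotmod :=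
  quotmod_pi (a *: repr x).

Lemma quotmod_scaleE a x : quotmod_scale a (quotmod_pi x) = quotmod_pi (a *: x).
Proof.
apply/quotmod_piE; rewrite -scalerBr -[X in U X]addr0; apply: UP => //.
by apply/quotmod_piE; apply: reprK.
Qed.

Fact quotmod_scaleA a b v : quotmod_scale a (quotmod_scale b v) = quotmod_scale (a * b) v.
Proof. by have [x <-] := quotmod_surj v; rewrite !quotmod_scaleE scalerA. Qed.
Fact quotmod_scale1 : left_id 1 quotmod_scale.
Proof. by move=> v; have [x <-] := quotmod_surj v; rewrite quotmod_scaleE scale1r. Qed.
Fact quotmod_scaleDr : right_distributive quotmod_scale +%R.
Proof.
move=> a u v; have [x <-] := quotmod_surj u; have [y <-] := quotmod_surj v.
by rewrite -raddfD !quotmod_scaleE scalerDr raddfD.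
Qed.
Fact quotmod_scaleDl v : {morph quotmod_scale^~ v : a b / a + b}.
Proof.
by move=> a b; have [x <-] := quotmod_surj v; rewrite !quotmod_scaleE scalerDl raddfD.
Qed.

HB.instance Definition _ := GRing.Zmodule_isLmodule.Build A quotmod
  quotmod_scaleA quotmod_scale1 quotmod_scaleDr quotmod_scaleDl.

Fact quotmod_pi_scalable : scalable quotmod_pi.
Proof. by move=> a x; rewrite -quotmod_scaleE. Qed.

HB.instance Definition _ := GRing.isScalable.Build A M quotmod *:%R quotmod_pi
  quotmod_pi_scalable.

Lemma quotient_module : exists (Q : lmodType A) (q : {linear M -> Q}),
  (forall y, exists x, q x = y) /\ (forall x, q x = 0 <-> U x).
Proof.
exists quotmod, quotmod_pi; split; first exact: quotmod_surj.
by move=> x; rewrite -(raddf0 quotmod_pi) quotmod_piE subr0.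
Qed.

Lemma submodule : exists (K : lmodType A) (i : {linear K -> M}),
  injective i /\ (forall x, U x <-> exists y, i y = x).
Proof.
exists submod, (val : submod -> M); split; first exact: val_inj.
move=> x; split=> [xU|[y <-]]; last exact/asboolP/submodP.
have xP : x \in submod_pred by apply/asboolP.
by exists (Submod xP).
Qed.

End SubQuotient.

Section LinearFactor.
Variable A : pzRingType.
Implicit Types M N P : lmodType A.

Definition linear_pack M N (h : M -> N) (hl : linear h) : {linear M -> N} :=
  HB.pack h (GRing.isLinear.Build A M N *:%R h hl).

Lemma linear_factor_inj M N P (i : {linear N -> P}) (g : {linear M -> P}) :
  injective i -> (forall x, exists y, i y = g x) ->
  exists h : {linear M -> N}, i \o h =1 g.
Proof.
move=> i_inj gP; have [h hE] := choice gP.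
have hl : linear h by move=> a x y; apply: i_inj; rewrite linearP !hE linearP.
by exists (linear_pack hl) => x; apply: hE.
Qed.

Lemma linear_factor_surj M N P (q : {linear M -> N}) (g : {linear M -> P}) :
  (forall y, exists x, q x = y) -> (forall x, q x = 0 -> g x = 0) ->
  exists h : {linear N -> P}, h \o q =1 g.
Proof.
move=> q_surj gP; have [s sE] := choice q_surj.
(* The section [s] need not be linear, but [g \o s] is, since [g] vanishes on the kernel of [q]. *)
have gs x : g (s (q x)) = g x.
  apply/eqP; rewrite -subr_eq0 -linearB; apply/eqP/gP.
  by rewrite linearB; apply/eqP; rewrite subr_eq0; apply/eqP/sE.
have hl : linear (g \o s).
  by move=> a x y; rewrite /= -linearP -[RHS]gs linearP !sE.
by exists (linear_pack hl) => x; apply: gs.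
Qed.

End LinearFactor.

(** * The abelian category of all modules *)

Section AllModules.
Variables (k : comNzRingType) (A : kalgebra k).
Implicit Types M N : lmodType A.

(** A finitely generated [A]-module need not be finitely generated over [k], so its underlying
    [k]-module is only sure to live in a category without finiteness. *)
Program Definition ModAll : lincat k :=
  @LinCat k (lmodType A) (fun M N => mod_hom M N) (fun M => idfun)
    (fun M N P (f : mod_hom N P) (g : mod_hom M N) => f \o g)
    _ _ _ _ _ _ _.
Next Obligation. by move=> *; apply: mod_homP. Qed.
Next Obligation. by move=> *; apply: mod_homP. Qed.
Next Obligation. by move=> *; apply: mod_homP. Qed.
Next Obligation. by move=> *; apply: mod_homP. Qed.
Next Obligation. by move=> *; apply: mod_homP => x /=; rewrite linearD. Qed.
Next Obligation. by move=> *; apply: mod_homP. Qed.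
Next Obligation.
by move=> *; apply: mod_homP => x; rewrite /= /mod_hom_scale_fun linearZ.
Qed.

Lemma ModAll_zero : exists Z : ModAll, is_zero_ob Z.
Proof.
pose Z : lmodType A := 'rV[A]_0; exists Z => M; split.
  exists (\0 : mod_hom Z M); split=> // f _; apply: mod_homP => x /=.
  by rewrite [x]thinmx0 linear0.
exists (\0 : mod_hom M Z); split=> // f _; apply: mod_homP => x /=.
by rewrite [RHS]thinmx0.
Qed.

Lemma ModAll_biproduct (M N : ModAll) :
  exists (S : ModAll) (i1 : mor M S) (i2 : mor N S) (p1 : mor S M)
    (p2 : mor S N), is_biproduct i1 i2 p1 p2.
Proof.
pose S : lmodType A := (M * N)%type.
have i1l : linear (fun x : M => (x, 0) : S).
  by move=> a x y; congr (_, _); rewrite /= scaler0 addr0.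
have i2l : linear (fun x : N => (0, x) : S).
  by move=> a x y; congr (_, _); rewrite /= scaler0 addr0.
have p1l : linear (fun x : S => x.1) by [].
have p2l : linear (fun x : S => x.2) by [].
exists S, (linear_pack i1l : mod_hom M S), (linear_pack i2l : mod_hom N S),
  (linear_pack p1l : mod_hom S M), (linear_pack p2l : mod_hom S N).
split; apply: mod_homP => //= -[x y].
by congr (_, _) => /=; rewrite ?addr0 ?add0r.
Qed.

Lemma injective_kernel (M N K : ModAll) (f : mor M N) (i : mor K M) :
  injective (i : mod_hom K M) ->
  (forall x, (f : mod_hom M N) x = 0 <-> exists y, (i : mod_hom K M) y = x) ->
  is_kernel f i.
Proof.
move=> i_inj fi; split.
  by apply: mod_homP => x /=; apply/fi; exists x.
move=> Z g fg.
have [|h hE] := linear_factor_inj (g := g) i_inj.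
  by move=> x; apply/fi; apply: (congr1 (fun u : mod_hom Z N => u x) fg).
exists (h : mod_hom Z K); split; first exact: mod_homP.
move=> h' h'E; apply: mod_homP => x; apply: i_inj; rewrite [LHS]hE.
by apply: (congr1 (fun u : mod_hom Z M => u x) (esym h'E)).
Qed.

Lemma surjective_cokernel (M N Q : ModAll) (f : mor M N) (q : mor N Q) :
  (forall y, exists x, (q : mod_hom N Q) x = y) ->
  (forall x, (q : mod_hom N Q) x = 0 <-> exists y, (f : mod_hom M N) y = x) ->
  is_cokernel f q.
Proof.
move=> q_surj qf; split.
  by apply: mod_homP => x /=; apply/qf; exists x.
move=> Z g gf.
have [|h hE] := linear_factor_surj (g := g) q_surj.
  move=> _ /qf[y <-]; exact: (congr1 (fun u : mod_hom M Z => u y) gf).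
exists (h : mod_hom Q Z); split; first exact: mod_homP.
move=> h' h'E; apply: mod_homP => y; have [x <-] := q_surj y; rewrite [LHS]hE.
by apply: (congr1 (fun u : mod_hom N Z => u x) (esym h'E)).
Qed.

Lemma ModAll_kernel (M N : ModAll) (f : mor M N) :
  exists (K : ModAll) (i : mor K M), injective (i : mod_hom K M) /\
    forall x, (f : mod_hom M N) x = 0 <-> exists y, (i : mod_hom K M) y = x.
Proof.
have [||K [i [i_inj iE]]] := @submodule A M (fun x => (f : mod_hom M N) x = 0).
- exact: linear0.
- by move=> a x y; rewrite linearP => -> ->; rewrite scaler0 addr0.
by exists K, (i : mod_hom K M).
Qed.

Lemma ModAll_cokernel (M N : ModAll) (f : mor M N) :
  exists (Q : ModAll) (q : mor N Q), is_cokernel f q /\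
    forall x, (q : mod_hom N Q) x = 0 <-> exists y, (f : mod_hom M N) y = x.
Proof.
have [||Q [q [q_surj qE]]] :=
    @quotient_module A N (fun x => exists y, (f : mod_hom M N) y = x).
- by exists 0; rewrite linear0.
- by move=> a _ _ [x <-] [y <-]; exists (a *: x + y); rewrite linearP.
by exists Q, (q : mod_hom N Q); split=> //; apply: surjective_cokernel.
Qed.

(** Test [f] against the inclusion of its kernel and the zero map. *)
Lemma ModAll_mono (M N : ModAll) (f : mor M N) :
  is_mono f -> injective (f : mod_hom M N).
Proof.
move=> f_mono; apply: raddf_inj => x fx0.
have [K [i [_ iE]]] := ModAll_kernel f.
have i0 : (i : mod_hom K M) = 0.
  apply: (f_mono K i (0 : mod_hom K M)); apply: mod_homP => y /=.
  by rewrite raddf0; apply/iE; exists y.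
by have [y <-] := (iE x).1 fx0; rewrite i0.
Qed.

(** Test [f] against the projection to its cokernel and the zero map. *)
Lemma ModAll_epi (M N : ModAll) (f : mor M N) :
  is_epi f -> forall y, exists x, (f : mod_hom M N) x = y.
Proof.
move=> f_epi y; have [Q [q [_ qE]]] := ModAll_cokernel f; apply/qE.
have -> : q = (\0 : mod_hom N Q).
  by apply: f_epi; apply: mod_homP => x; apply/qE; exists x.
by [].
Qed.

Lemma ModAll_abelian : is_abelian ModAll.
Proof.
split.
- exact: ModAll_zero.
- exact: ModAll_biproduct.
- move=> M N f; have [K [i [i_inj iE]]] := ModAll_kernel f.
  by exists K, i; apply: injective_kernel.
- by move=> M N f; have [Q [q [? _]]] := ModAll_cokernel f; exists Q, q.
- move=> M N f /ModAll_mono f_inj; have [Q [q [_ qE]]] := ModAll_cokernel f.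
  by exists Q, q; apply: injective_kernel.
- move=> M N f /ModAll_epi f_surj.
  have [K [i [_ iE]]] := ModAll_kernel f.
  by exists K, i; apply: surjective_cokernel.
Qed.

End AllModules.

(** * Left modules as representations on [k]-modules *)

Section RepresentationsAsModules.
Variables (k : comNzRingType) (A : kalgebra k).

Fact base_alg_central (c a : k) : (idfun : {rmorphism k -> k}) c * a = a * idfun c.
Proof. exact: mulrC. Qed.

Definition base_alg : kalgebra k := @KAlgebra k k idfun base_alg_central.

Section Scalars.
Variable M : lmodType A.

(** An alias of the carrier, so that a [k]-module structure can be attached beside the [A]-module
    structure. *)
Definition res_scalars : Type := M.
HB.instance Definition _ := GRing.Zmodule.on res_scalars.

Definition res_scale (c : k) (x : res_scalars) : res_scalars :=
  alg_map A c *: (x : M).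

Fact res_scaleA c d v : res_scale c (res_scale d v) = res_scale (c * d) v.
Proof. by rewrite /res_scale scalerA rmorphM. Qed.
Fact res_scale1 : left_id 1 res_scale.
Proof. by move=> v; rewrite /res_scale rmorph1 scale1r. Qed.
Fact res_scaleDr : right_distributive res_scale +%R.
Proof. by move=> c u v; rewrite /res_scale scalerDr. Qed.
Fact res_scaleDl v : {morph res_scale^~ v : c d / c + d}.
Proof. by move=> c d; rewrite /res_scale rmorphD scalerDl. Qed.

HB.instance Definition _ := GRing.Zmodule_isLmodule.Build k res_scalars
  res_scaleA res_scale1 res_scaleDr res_scaleDl.

Definition res_module : ModAll base_alg := (res_scalars : lmodType k).

Fact mul_linear (a : A) : linear (fun x : res_module => a *: (x : M) : res_module).
Proof.
move=> c x y; rewrite [LHS]scalerDr; congr (_ + _).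
by rewrite [LHS]scalerA [RHS]scalerA alg_central.
Qed.

Definition mul_act (a : A) : End res_module :=
  linear_pack (mul_linear a) : mod_hom res_module res_module.

Fact mul_act_additive : zmod_morphism mul_act.
Proof. by move=> a b; apply: mod_homP => x; exact: (scalerBl a b (x : M)). Qed.
Fact mul_act_monoid : monoid_morphism mul_act.
Proof.
split=> [|a b]; apply: mod_homP => x; first exact: (scale1r (x : M)).
exact: (esym (scalerA a b (x : M))).
Qed.
HB.instance Definition _ := GRing.isZmodMorphism.Build A (End res_module)
  mul_act mul_act_additive.
HB.instance Definition _ := GRing.isMonoidMorphism.Build A (End res_module)
  mul_act mul_act_monoid.

Fact mul_act_map (c : k) : mul_act (alg_map A c) = alg_map (End res_module) c.
Proof. exact: mod_homP. Qed.

Definition module_rep : rep A (ModAll base_alg) :=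
  MkRep (@KAlgebraHom k A (End res_module) mul_act mul_act_map).

End Scalars.

Section ModuleRepHom.
Variables M N : lmodType A.

Fact res_hom_linear (f : mod_hom M N) :
  linear (f : res_module M -> res_module N).
Proof. by move=> c x y; apply: (linearP f (alg_map A c)). Qed.

Fact res_hom_subproof (f : mod_hom M N) :
  (linear_pack (res_hom_linear f) : mod_hom (res_module M) (res_module N))
    \in @rep_hom_pred k A (ModAll base_alg) (module_rep M) (module_rep N).
Proof. by apply/asboolP => a; apply: mod_homP => x /=; rewrite linearZ. Qed.

Definition module_rep_hom (f : mod_hom M N) :
  rep_hom (module_rep M) (module_rep N) := RepHom (res_hom_subproof f).

Fact module_rep_hom_linear : linear module_rep_hom.
Proof. by move=> c f g; apply: val_inj; apply: mod_homP. Qed.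

HB.instance Definition _ := GRing.isLinear.Build k (mod_hom M N)
  (rep_hom (module_rep M) (module_rep N)) *:%R module_rep_hom
  module_rep_hom_linear.

End ModuleRepHom.

Program Definition module_rep_functor :
    linfunctor (ModAll A) (Rep A (ModAll base_alg)) :=
  @LinFunctor k (ModAll A) (Rep A (ModAll base_alg)) module_rep
    (fun M N => @module_rep_hom M N) _ _.
Next Obligation. by move=> M; apply: val_inj; apply: mod_homP. Qed.
Next Obligation. by move=> *; apply: val_inj; apply: mod_homP. Qed.

Section RepModule.
Variable X : rep A (ModAll base_alg).

Let V : lmodType base_alg := rep_ob X.
Let act (a : A) : mod_hom V V := rep_act X a.

Definition rep_module : Type := V.
HB.instance Definition _ := GRing.Zmodule.on rep_module.

Definition rep_scale (a : A) (v : rep_module) : rep_module := act a v.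

Fact rep_scaleA a b v : rep_scale a (rep_scale b v) = rep_scale (a * b) v.
Proof. by rewrite /rep_scale /act rmorphM. Qed.
Fact rep_scale1 : left_id 1 rep_scale.
Proof. by move=> v; rewrite /rep_scale /act rmorph1. Qed.
Fact rep_scaleDr : right_distributive rep_scale +%R.
Proof. by move=> a u v; apply: linearD. Qed.
Fact rep_scaleDl v : {morph rep_scale^~ v : a b / a + b}.
Proof. by move=> a b; rewrite /rep_scale /act rmorphD. Qed.

HB.instance Definition _ := GRing.Zmodule_isLmodule.Build A rep_module
  rep_scaleA rep_scale1 rep_scaleDr rep_scaleDl.

Definition rep_as_module : lmodType A := rep_module.

(** Since the action is a morphism of [k]-algebras, restricting scalars returns the original
    [k]-module; hence the identity map is an isomorphism of representations. *)
Lemma rep_module_scalars (c : k) (v : V) :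
  alg_map A c *: (v : rep_as_module) = c *: v.
Proof. by rewrite [LHS]/(act _ _) /act alg_hom_map. Qed.

Fact rep_module_linear : linear (idfun : res_module rep_as_module -> V).
Proof. by move=> c x y; rewrite /= -rep_module_scalars. Qed.

Fact rep_module_linear' : linear (idfun : V -> res_module rep_as_module).
Proof. by move=> c x y; rewrite /= -rep_module_scalars. Qed.

Lemma module_rep_ess_surj : exists f : mor (module_rep_functor rep_as_module) X,
  is_iso f.
Proof.
have fP : (linear_pack rep_module_linear : mod_hom (res_module rep_as_module) V)
    \in @rep_hom_pred k A (ModAll base_alg) (module_rep rep_as_module) X.
  by apply/asboolP => a; apply: mod_homP.
have gP : (linear_pack rep_module_linear' : mod_hom V (res_module rep_as_module))
    \in @rep_hom_pred k A (ModAll base_alg) X (module_rep rep_as_module).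
  by apply/asboolP => a; apply: mod_homP.
by exists (RepHom fP), (RepHom gP); split; apply: val_inj; apply: mod_homP.
Qed.

End RepModule.

Lemma ModAll_equivalent_Rep : lin_equivalent (ModAll A) (Rep A (ModAll base_alg)).
Proof.
apply/lin_equivalentP; exists module_rep_functor; split.
- move=> M N [g gP].
  (* Additivity comes from [k]-linearity, and [A]-homogeneity is the intertwining condition. *)
  pose g' : mod_hom (res_module M) (res_module N) := g.
  have gl : linear (g' : M -> N).
    move=> a x y; rewrite linearD; congr (_ + _).
    move/asboolP: gP => /(_ a).
    exact: (congr1 (fun h : mod_hom (res_module M) (res_module N) => h x)).
  exists (linear_pack gl : mod_hom M N).
  by apply: val_inj; apply: mod_homP.
- move=> M N f g fg; apply: mod_homP => x.
  have := congr1 (fun h : rep_hom (module_rep M) (module_rep N) =>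
    (rep_hom_val h : mod_hom (res_module M) (res_module N)) x) fg.
  by [].
- by move=> X; exists (rep_as_module X); apply: module_rep_ess_surj.
Qed.

End RepresentationsAsModules.

(** * Equivalences preserve finite generation *)

Section Spans.
Variables (k : comNzRingType) (A : kalgebra k) (M : lmodType A).
Implicit Type s t : seq M.

Definition in_span s (x : M) : Prop :=
  exists a : 'I_(size s) -> A, x = \sum_i a i *: tnth (in_tuple s) i.

Lemma in_span0 s : in_span s 0.
Proof. by exists (fun=> 0); rewrite big1 // => i _; rewrite scale0r. Qed.

Lemma in_spanP s a x y : in_span s x -> in_span s y -> in_span s (a *: x + y).
Proof.
move=> [b ->] [c ->]; exists (fun i => a * b i + c i).
rewrite scaler_sumr -big_split; apply: eq_bigr => i _ /=.
by rewrite scalerDl scalerA.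
Qed.

Lemma mem_in_span s x : x \in s -> in_span s x.
Proof.
move=> /(seq_tnthP (s := s))/=[i ->]; exists (fun j => if j == i then 1 else 0).
rewrite (bigD1 i) //= eqxx scale1r big1 ?addr0 // => j /negPf->.
by rewrite scale0r.
Qed.

Lemma in_spanS s t x : {subset s <= t} -> in_span s x -> in_span t x.
Proof.
move=> st [a ->]; elim/big_ind: _ => [|y z yt zt|i _]; first exact: in_span0.
  by rewrite -[y]scale1r; apply: in_spanP.
rewrite -[_ *: _]addr0; apply: in_spanP; last exact: in_span0.
by apply/mem_in_span/st/mem_tnth.
Qed.

Lemma span_fg s : (forall x, in_span s x) -> finitely_generated M.
Proof. by move=> sM; exists (size s), (tnth (in_tuple s)). Qed.

End Spans.

Lemma fg_surjection (k : comNzRingType) (A : kalgebra k) (M N : lmodType A)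
    (f : {linear M -> N}) :
  (forall y, exists x, f x = y) -> finitely_generated M -> finitely_generated N.
Proof.
move=> f_surj [n [e eM]]; exists n, (f \o e) => y; have [x <-] := f_surj y.
have [a ->] := eM x; exists a; rewrite linear_sum.
by apply: eq_bigr => i _; rewrite linearZ.
Qed.

Lemma ModAll_iso_bij (k : comNzRingType) (A : kalgebra k) (M N : ModAll A)
  (f : mor M N) : is_iso f -> bijective (f : mod_hom M N).
Proof.
move=> [g [gf fg]]; exists (g : mod_hom N M) => x.
  exact: (congr1 (fun h : mod_hom M M => h x) gf).
exact: (congr1 (fun h : mod_hom N N => h x) fg).
Qed.

(* [N] is the directed union of its finitely generated submodules; [G]
   preserves this union, and a finitely generated module is one term of it. *)
Lemma fg_reflected (k : comNzRingType) (A B : kalgebra k)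
    (G : linfunctor (ModAll B) (ModAll A)) (N : lmodType B) :
  full G -> faithful G -> ess_surj G ->
  finitely_generated (G N) -> finitely_generated N.
Proof.
move=> Gf Gi Gs [n [e eGN]].
have sub s := submodule (in_span0 s) (@in_spanP _ _ N s).
pose K s : ModAll B := projT1 (cid (sub s)).
pose i s : mor (K s) N := projT1 (cid (projT2 (cid (sub s)))).
have i_inj s : injective (i s : mod_hom (K s) N).
  by case: (projT2 (cid (projT2 (cid (sub s))))).
have iE s x : in_span s x <-> exists y, (i s : mod_hom (K s) N) y = x.
  by case: (projT2 (cid (projT2 (cid (sub s)))))=> _ sE; exact: sE.
pose Gi_ s : mod_hom (G (K s)) (G N) := fhom G (i s).
pose U s y := exists x, Gi_ s x = y.
have UP s a x y : U s x -> U s y -> U s (a *: x + y).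
  by move=> [x' <-] [y' <-]; exists (a *: x' + y'); rewrite linearP.
have US s t y : {subset s <= t} -> U s y -> U t y.
  move=> st [x <-].
  have [|h hE] := linear_factor_inj (g := (i s : mod_hom (K s) N)) (i_inj t).
    by move=> z; apply/iE/(in_spanS st)/iE; exists z.
  exists ((fhom G (h : mor (K s) (K t)) : mod_hom _ _) x).
  have ist : i s = i t \oc (h : mor (K s) (K t)).
    by apply: mod_homP => z; rewrite -hE.
  by rewrite /Gi_ ist fhomM.
(* Divide [G N] by the union of the images of the [G (K s)]. The union is a submodule because stages
   [s] and [t] both lie in stage [s ++ t]; the aim is [q = 0]. *)
have [||Q [q [q_surj qE]]] := @quotient_module A (G N) (fun y => exists s, U s y).
- by exists [::], 0; rewrite linear0.
- move=> a x y [s xs] [t yt]; exists (s ++ t); apply: UP.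
    by apply: US xs => z zs; rewrite mem_cat zs.
  by apply: US yt => z zt; rewrite mem_cat zt orbT.
have q0 : (q : mor (G N) Q) = 0.
  have [Q' [v [w [wv vw]]]] := Gs Q.
  (* Lift [q] to a map out of [N]. It kills every [x], since [x] lies in the cyclic submodule [K
     [:: x]], whose image under [G] dies in [Q]. *)
  have [q' q'E] := Gf _ _ (w \oc (q : mor (G N) Q)).
  have q'0 : q' = 0.
    apply: mod_homP => x.
    have xs : in_span [:: x] x by apply: mem_in_span; rewrite inE.
    have [y <-] := (iE _ _).1 xs.
    suff q'i : q' \oc i [:: x] = 0.
      exact: (congr1 (fun h : mod_hom (K [:: x]) Q' => h y) q'i).
    apply: Gi; rewrite fhomM q'E linear0 -mcompA.
    suff -> : (q : mor (G N) Q) \oc fhom G (i [:: x]) = 0 by rewrite mcompm0.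
    by apply: mod_homP => z; apply/qE; exists [:: x], z.
  rewrite -[LHS](mcomp1m (q : mor (G N) Q)) -vw -mcompA -q'E q'0 linear0.
  exact: mcompm0.
have allU y : exists s, U s y by apply/qE; rewrite q0.
have [s sE] := choice (fun j => allU (e j)).
(* Concatenating stages that contain the finitely many generators [e j] gives one stage that
   exhausts [G N]. *)
pose t := flatten [seq s j | j <- enum 'I_n].
have tU y : U t y.
  have [a ->] := eGN y; elim/big_ind: _ => [|x z xU zU|j _].
  - by exists 0; rewrite linear0.
  - by rewrite -[x]scale1r; apply: UP.
  rewrite -[_ *: _]addr0; apply: UP; last by exists 0; rewrite linear0.
  apply: US (sE j) => z zs; apply/flattenP; exists (s j) => //.
  by apply: map_f; rewrite mem_enum.
(* Surjectivity of [G (i t)] and faithfulness of [G] make [i t] epi, hence surjective, so [t] spans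
   [N]. *)
have i_epi : is_epi (i t).
  move=> Z g h gh; apply: Gi; apply: mod_homP => y; have [x <-] := tU y.
  have : fhom G g \oc fhom G (i t) = fhom G h \oc fhom G (i t) by rewrite -!fhomM gh.
  exact: (congr1 (fun u : mod_hom (G (K t)) (G Z) => u x)).
apply: (@span_fg _ _ _ t) => x; apply/iE; exact: ModAll_epi i_epi x.
Qed.

Section RestrictToFg.
Variables (k : comNzRingType) (A B : kalgebra k).
Variables (F : linfunctor (ModAll A) (ModAll B)).
Hypothesis F_fg : forall M : lmodType A,
  finitely_generated M -> finitely_generated (F M).

Program Definition fg_functor : linfunctor (Mod A) (Mod B) :=
  @LinFunctor k (Mod A) (Mod B) (fun M => FgMod (F_fg (fgmod_fg M)))
    (fun M N => @fhom k (ModAll A) (ModAll B) F M N) _ _.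
Next Obligation. by move=> M; exact: (fhom1 F (fgmod_sort M : ModAll A)). Qed.
Next Obligation. move=> M N P f g.
exact: (@fhomM k (ModAll A) (ModAll B) F (fgmod_sort M) (fgmod_sort N)
  (fgmod_sort P) f g). Qed.

End RestrictToFg.

Lemma Mod_equivalent (k : comNzRingType) (A B : kalgebra k) :
  lin_equivalent (ModAll A) (ModAll B) -> lin_equivalent (Mod A) (Mod B).
Proof.
move=> [F [G [GF FG]]].
have Fi := nat_iso_faithful GF; have Gi := nat_iso_faithful FG.
have Ff := nat_iso_full GF Gi; have Gf := nat_iso_full FG Fi.
have Fs := nat_iso_ess_surj FG; have Gs := nat_iso_ess_surj GF.
(* As [G1 (F1 M)] is isomorphic to [M], it is finitely generated, and [fg_reflected] descends this
   to [F1 M]. *)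
have fg (A1 A2 : kalgebra k) (F1 : linfunctor (ModAll A1) (ModAll A2))
    (G1 : linfunctor (ModAll A2) (ModAll A1)) :
    full G1 -> faithful G1 -> ess_surj G1 ->
    nat_iso (comp_functor G1 F1) (id_functor _) ->
    forall M : lmodType A1, finitely_generated M -> finitely_generated (F1 M).
  move=> G1f G1i G1s [eta [eta_iso _]] M; have [v [ve ev]] := eta_iso M => M_fg.
  apply: (fg_reflected G1f G1i G1s).
  have [v' vK vK'] : bijective (v : mod_hom M (G1 (F1 M))).
    by apply: ModAll_iso_bij; exists (eta M).
  by apply: (fg_surjection (f := (v : mod_hom M (G1 (F1 M))))) M_fg => y; exists (v' y).
have Ffg := fg _ _ _ _ Gf Gi Gs GF; have Gfg := fg _ _ _ _ Ff Fi Fs FG.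
apply/lin_equivalentP; exists (fg_functor Ffg); split.
- by move=> M N; apply: Ff.
- by move=> M N; apply: Fi.
move=> N; exists (FgMod (Gfg _ (fgmod_fg N))).
by have [eta [eta_iso _]] := FG; exists (eta N); apply: eta_iso.
Qed.

(** * The Morita context of an equivalence *)

Section Opposite.
Variable k : comNzRingType.

Definition opp_cat (C : lincat k) : lincat k :=
  @LinCat k C (fun X Y => mor Y X) (fun X => idm X) (fun X Y Z f g => g \oc f)
    (fun X Y f => mcompm1 f) (fun X Y f => mcomp1m f)
    (fun X Y Z W f g h => esym (mcompA h g f)) (fun X Y Z f g h => mcompDr h f g)
    (fun X Y Z f g h => mcompDl g h f) (fun X Y Z c f g => mcompZr c g f)
    (fun X Y Z c f g => mcompZl c g f).

(** Endomorphisms of the regular left module are right multiplications, so products are reversed. In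
    the opposite category this becomes an isomorphism of algebras. *)
Record anti_iso (R : kalgebra k) (C : lincat k) (a : C) (al : R -> mor a a) :
    Prop := AntiIso {
  ai_B : forall x y, al (x - y) = al x - al y;
  ai_1 : al 1 = idm a;
  ai_M : forall x y, al (x * y) = al y \oc al x;
  ai_map : forall c, al (alg_map R c) = c *: idm a;
  ai_bij : bijective al
}.

Lemma anti_iso_fhom (R : kalgebra k) (C D : lincat k) (F : linfunctor C D)
    (a : C) (al : R -> mor a a) :
  full F -> faithful F -> anti_iso al -> anti_iso (fun x => fhom F (al x)).
Proof.
move=> Ff Fi [alB al1 alM almap [be alK beK]]; split.
- by move=> x y; rewrite alB linearB.
- by rewrite al1 fhom1.
- by move=> x y; rewrite alM fhomM.
- by move=> c; rewrite almap linearZ fhom1.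
pose inv y := be (projT1 (cid (Ff _ _ y))).
have invK : cancel inv (fun x => fhom F (al x)).
  by move=> y; rewrite /inv beK; case: cid.
exists inv => // x; rewrite /inv; case: cid => y /= /Fi->; exact: alK.
Qed.

Lemma opp_anti_iso (R : kalgebra k) (C : lincat k) (I : Type) (o : I -> C)
    (i : I) (al : R -> mor (o i) (o i)) : anti_iso al ->
  exists h : kalgebra_hom R (@End k (opp_cat (induced_cat o)) i), bijective h.
Proof.
move=> [alB al1 alM almap al_bij].
pose f : R -> @End k (opp_cat (induced_cat o)) i := al.
pose f1 := GRing.isZmodMorphism.Build _ _ f alB.
pose f2 := GRing.isMonoidMorphism.Build _ _ f (conj al1 alM).
pose fr : {rmorphism R -> @End k (opp_cat (induced_cat o)) i} := HB.pack f f1 f2.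
by exists (@KAlgebraHom k R _ fr almap).
Qed.

(** Reversing arrows swaps the families [r] and [s] and keeps the equation, so being a summand of a
    power is self-dual. *)
Definition opp_retraction (C : lincat k) (I : Type) (o : I -> C) (i j : I)
    (rt : retraction (o i) (o j)) : @retraction k (opp_cat (induced_cat o)) i j :=
  @Retraction k (opp_cat (induced_cat o)) i j (rt_n rt) (rt_s rt) (rt_r rt)
    (rt_rs rt).

Lemma Rep_equivalent_of_retractions (D : lincat k) (a p : D) (R S : kalgebra k)
    (al : R -> mor a a) (be : S -> mor p p) (C : lincat k) :
  anti_iso al -> anti_iso be -> inhabited (retraction a p) ->
  inhabited (retraction p a) -> is_abelian C -> lin_equivalent (Rep R C) (Rep S C).
Proof.
move=> al_iso be_iso [ap] [pa] C_ab.
(* Labelling by [bool] keeps two objects even when [a] and [p] coincide; [R] sits at [true] and [S]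
   at [false]. *)
pose o (b : bool) := if b then a else p; pose E := opp_cat (induced_cat o).
have [f f_bij] := @opp_anti_iso R D bool o true al al_iso.
have [g g_bij] := @opp_anti_iso S D bool o false be be_iso.
have rta (c : E) : inhabited (retraction c (true : E)).
  by split; apply: opp_retraction; case: c; [apply: id_retraction|apply: pa].
have rtp (c : E) : inhabited (retraction c (false : E)).
  by split; apply: opp_retraction; case: c; [apply: ap|apply: id_retraction].
have [rt] := rta false; have [rt'] := rtp true.
apply: (change_base_equivalent (al := f) (be := g) _ _ rt rt').
- by case: f_bij => f' _ f'K x; exists (f' x); apply: f'K.
- by case: g_bij => g' _ g'K x; exists (g' x); apply: g'K.
- exact: restrict_ess_surj C_ab f_bij rta.
- exact: restrict_ess_surj C_ab g_bij rtp.
Qed.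

Definition retraction_fhom (C D : lincat k) (F : linfunctor C D) (c b : C)
  (rt : retraction c b) : retraction (F c) (F b) := Retraction (fhom_rt rt F).

Lemma retraction_iso (C : lincat k) (c b b' : C) (u : mor b b') :
  is_iso u -> retraction c b -> inhabited (retraction c b').
Proof.
move=> [v [vu _]] rt; split.
apply: (@Retraction _ _ _ _ (rt_n rt) (fun i => rt_r rt i \oc v)
  (fun i => u \oc rt_s rt i)).
rewrite -(rt_rs rt); apply: eq_bigr => i _.
by rewrite -mcompA (mcompA v) vu mcomp1m.
Qed.

(** Joint epimorphy of the [r i] expresses an epimorphism from a finite power of [a] to [p] by
    composition alone, so it is easily carried through equivalences. *)
Definition generates (C : lincat k) (a p : C) : Prop :=
  exists (n : nat) (r : 'I_n -> mor a p), forall (Z : C) (g h : mor p Z),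
    (forall i, g \oc r i = h \oc r i) -> g = h.

Lemma generates_fhom (C D : lincat k) (F : linfunctor C D) (a p : C) :
  full F -> faithful F -> ess_surj F -> generates a p -> generates (F a) (F p).
Proof.
move=> Ff Fi Fs [n [r rP]]; exists n, (fun i => fhom F (r i)) => Z g h gh.
have [Z' [v [w [wv vw]]]] := Fs Z.
have [g' g'E] := Ff _ _ (w \oc g); have [h' h'E] := Ff _ _ (w \oc h).
have gh' : g' = h'.
  by apply: rP => i; apply: Fi; rewrite !fhomM g'E h'E -!mcompA gh.
by rewrite -[g]mcomp1m -vw -mcompA -g'E gh' h'E mcompA vw mcomp1m.
Qed.

Lemma generates_iso (C : lincat k) (a p p' : C) (u : mor p p') :
  is_iso u -> generates a p -> generates a p'.
Proof.
move=> [v [_ uv]] [n [r rP]]; exists n, (fun i => u \oc r i) => Z g h gh.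
rewrite -[g]mcompm1 -[h]mcompm1 -uv !mcompA; congr (_ \oc _).
by apply: rP => i; rewrite -!mcompA gh.
Qed.

End Opposite.

Lemma mod_hom_sumE (k : comNzRingType) (A : kalgebra k) (M N : lmodType A)
    (I : Type) (r : seq I) (P : pred I) (F : I -> mod_hom M N) (x : M) :
  (\sum_(i <- r | P i) F i) x = \sum_(i <- r | P i) F i x.
Proof. by apply: (big_morph (fun f : mod_hom M N => f x)). Qed.

(** * The regular module as a projective generator *)

Section RegularModule.
Variables (k : comNzRingType) (A : kalgebra k).

Fact regular_fg : finitely_generated (A^o : lmodType A).
Proof.
by exists 1, (fun=> 1) => x; exists (fun=> x); rewrite big_ord1 [RHS]mulr1.
Qed.

Definition regular : Mod A := FgMod regular_fg.

Fact scale_linear (M : lmodType A) (x : M) : linear (fun a : A^o => (a : A) *: x).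
Proof. by move=> a b c; rewrite scalerDl scalerA. Qed.

Definition scale_hom (M : Mod A) (x : fgmod_sort M) : mor regular M :=
  linear_pack (scale_linear x) : mod_hom _ _.

(** An endomorphism is right multiplication by its value at [1], so evaluation at [1] is the
    inverse. *)
Lemma regular_anti_iso : anti_iso (fun x : A => scale_hom (x : fgmod_sort regular)).
Proof.
split.
- by move=> x y; apply: mod_homP => a; apply: (mulrBr (a : A)).
- by apply: mod_homP => a; apply: (mulr1 (a : A)).
- by move=> x y; apply: mod_homP => a; apply: (mulrA (a : A)).
- by move=> c; apply: mod_homP => a; apply: (esym (alg_central c (a : A))).
exists (fun f => (f : mod_hom A^o A^o) 1) => [x|f]; first exact: mul1r.
apply: mod_homP => a.
have fa : (f : mod_hom A^o A^o) (a *: (1 : A^o)) = a *: (f : mod_hom A^o A^o) 1.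
  exact: linearZ.
by rewrite [a *: _ in LHS]mulr1 in fa; rewrite [RHS]fa.
Qed.

Lemma regular_generates (M : Mod A) : generates regular M.
Proof.
have [n [e eM]] := fgmod_fg M; exists n, (fun i => scale_hom (e i)).
move=> Z g h gh; apply: mod_homP => x; have [a ->] := eM x.
rewrite !linear_sum; apply: eq_bigr => i _.
exact: (congr1 (fun u : mod_hom A^o Z => u (a i)) (gh i)).
Qed.

(* Joint epimorphy onto the regular module makes [1] a combination of values
   of the [r i]; the coefficients give the sections. *)
Lemma generates_regular (M : Mod A) : generates M regular ->
  inhabited (retraction regular M).
Proof.
move=> [n [r rP]].
pose r' i : mod_hom M A^o := r i.
have [||Q [q [q_surj qE]]] := @quotient_module A A^o
    (fun y => exists x : 'I_n -> M, y = \sum_i r' i (x i)).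
- by exists (fun=> 0); rewrite big1 // => i _; rewrite linear0.
- move=> a _ _ [x ->] [y ->]; exists (fun i => a *: x i + y i).
  by rewrite scaler_sumr -big_split; apply: eq_bigr => i _; rewrite linearP.
(* The quotient of [A] by the sum of the images of the [r i] is finitely generated, so joint
   epimorphy applies to it: [q] and [0] agree on every [r i]. *)
pose Q' : Mod A := FgMod (fg_surjection q_surj regular_fg).
have q0 : (q : mor regular Q') = 0.
  apply: rP => i; rewrite mcomp0m; apply: mod_homP => x; apply/qE.
  exists (fun j => if j == i then x else 0).
  rewrite (bigD1 i) //= eqxx big1 ?addr0 // => j /negPf->.
  by rewrite linear0.
have [x xE] : exists x : 'I_n -> M, 1 = \sum_i r' i (x i) by apply/qE; rewrite q0.
split; apply: (@Retraction _ _ regular M n r (fun i => scale_hom (x i))).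
apply: mod_homP => a; rewrite mod_hom_sumE.
have -> : idm regular a = a *: (1 : A^o) by rewrite [RHS]mulr1.
by rewrite xE scaler_sumr; apply: eq_bigr => i _; rewrite -linearZ.
Qed.

End RegularModule.

Lemma Rep_equivalent (k : comNzRingType) (A B : kalgebra k) (C : lincat k) :
  lin_equivalent (Mod A) (Mod B) -> is_abelian C ->
  lin_equivalent (Rep A C) (Rep B C).
Proof.
move=> [F [G [GF FG]]].
have Fi := nat_iso_faithful GF; have Gi := nat_iso_faithful FG.
have Ff := nat_iso_full GF Gi; have Gf := nat_iso_full FG Fi.
have Fs := nat_iso_ess_surj FG; have Gs := nat_iso_ess_surj GF.
have [eta [eta_iso _]] := GF; have [eps [eps_iso _]] := FG.
pose a := regular A; pose q := regular B.
apply: (@Rep_equivalent_of_retractions _ (Mod A) a (G q) A B).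
- exact: regular_anti_iso.
- exact: (anti_iso_fhom Gf Gi (regular_anti_iso B)).
(* [q] generates the finitely generated module [F a], so [G q] generates [G (F a)], which is
   isomorphic to [a]. *)
- apply: generates_regular; apply: (generates_iso (eta_iso a)).
  exact/(generates_fhom Gf Gi Gs)/regular_generates.
(* Symmetrically, [F a] generates [F (G q)], isomorphic to [q]; the resulting retraction in [Mod B]
   is then carried back by [G]. *)
- have [rt] : inhabited (retraction q (F a)).
    apply: generates_regular; apply: (generates_iso (eps_iso q)).
    exact/(generates_fhom Ff Fi Fs)/regular_generates.
  exact: (retraction_iso (eta_iso a) (retraction_fhom G rt)).
Qed.

Theorem lemma2p5 (k : idomainType) (hk : is_pid k) (A A' : kalgebra k) :
  (forall C : lincat k, is_abelian C -> lin_equivalent (Rep A C) (Rep A' C))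
  <-> lin_equivalent (Mod A) (Mod A').
Proof.
split=> [repE|modE C C_ab]; last exact: Rep_equivalent.
apply: Mod_equivalent.
apply: lin_equivalent_trans (ModAll_equivalent_Rep A) _.
apply: lin_equivalent_trans (repE _ (ModAll_abelian _)) _.
exact/lin_equivalent_sym/ModAll_equivalent_Rep.
Qed.
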